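(* Let $n>2$ and let $\Delta,\rho$ be functions of $b^2$ with $1+2b^2\rho'\neq0$. Then the system of equations $X=Y=Z=0$ is equivalent to the system $X=0$, $T=0$, where $$\begin{aligned}T=\ &(a^2-\mu b^2)\big\{\Delta^2-b^2\Delta'(1+2b^2\rho')-\Delta(1+2b^2\rho')^2+2b^2\Delta(1+2b^2\rho')'\big\}\\&+\mu b^2\big\{\Delta^2-\Delta(1+2b^2\rho')\big\},\end{aligned}$$ and $X,Y,Z$ are the expressions $$\begin{aligned}X=\frac{1}{b^2\Delta}\Big\{&a^2\Delta(n-2\Delta)+b^2[\mu\Delta-(a^2-\mu b^2)\Delta'](1+2b^2\rho')-(n-2)(a^2-\mu b^2)\Delta(1+2b^2\rho')^2\\&-2(a^2-\mu b^2)b^2\Delta(1+2b^2\rho')'-(n-1)\bar\mu b^2\Delta e^{2\rho}\Big\},\end{aligned}$$ $$\begin{aligned}Y=-\frac{1}{b^4\Delta}\Big\{&a^2\Delta(1-\Delta)[n+(n-2)\Delta]+(2a^2-3\mu b^2)b^2\Delta\Delta'-(a^2-\mu b^2)b^4\Delta'^2+2(a^2-\mu b^2)b^4\Delta\Delta''\\&+\mu b^2\Delta(1-\Delta)(1+2b^2\rho')-(a^2-\mu b^2)b^2[1-(n-1)\Delta]\Delta'(1+2b^2\rho')\\&-(n-2)(a^2-\mu b^2)\Delta(1-\Delta)(1+2b^2\rho')^2-2(a^2-\mu b^2)b^2\Delta(1-\Delta)(1+2b^2\rho')'\\&-(n-1)\bar\mu b^2\Delta(1-\Delta)e^{2\rho}\Big\},\end{aligned}$$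 $$\begin{aligned}Z=-\frac{1}{(a^2-\mu b^2)b^4\Delta^2}\Big\{&a^2\Delta^2(n-2\Delta)+(2a^2-3\mu b^2)b^2\Delta\Delta'-(a^2-\mu b^2)b^4\Delta'^2+2(a^2-\mu b^2)b^4\Delta\Delta''\\&-(n-2)\mu b^2\Delta^2(1+2b^2\rho')-(n-2)(a^2-\mu b^2)\Delta^2(1+2b^2\rho')^2\\&+2(n-2)(a^2-\mu b^2)b^2\Delta^2(1+2b^2\rho')'\Big\}.\end{aligned}$$
   Context: Here $n$ is an integer, $a\neq0$, $\mu$, $\bar\mu$ are real constants, and $b^2$ is treated as an independent real variable ranging over an open interval in $(0,\infty)$ on which $a^2-\mu b^2>0$; $\Delta=\Delta(b^2)>0$ and $\rho=\rho(b^2)$ are smooth real functions on this interval, and a prime denotes $d/d(b^2)$ (so $(1+2b^2\rho')'=2\rho'+2b^2\rho''$). Equations are required to hold identically on the interval. *)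

(* Defs.v *)
(* Stdlib reals with Coquelicot.  Throughout, the real variable t stands for
   b^2, so that b^4 is t^2, and a prime is the derivative in t. *)
From Stdlib Require Import Reals ZArith.
From Coquelicot Require Import Coquelicot.
Local Open Scope R_scope.

(* The open interval (lo, hi); hi may be +oo. *)
Definition in_itv (lo : R) (hi : Rbar) (t : R) : Prop :=
  lo < t /\ Rbar_lt t hi.

(* Functions on the interval are total functions R -> R of which only the values
   on the (open) interval matter; derivatives there are local. *)
Definition smooth_on (lo : R) (hi : Rbar) (f : R -> R) : Prop :=
  forall t : R, in_itv lo hi t -> forall k : nat, ex_derive_n f k t.

(* 1 + 2 b^2 rho' *)
Definition exprW (rho : R -> R) (t : R) : R := 1 + 2 * t * Derive rho t.

Definition exprX (n : Z) (a mu mubar : R) (Delta rho : R -> R) (t : R) : R :=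
  let N := IZR n in
  let k := a ^ 2 - mu * t in
  let D := Delta t in
  let D' := Derive Delta t in
  let w := exprW rho t in
  let w' := Derive (exprW rho) t in
  1 / (t * D) *
  ( a ^ 2 * D * (N - 2 * D)
    + t * (mu * D - k * D') * w
    - (N - 2) * k * D * w ^ 2
    - 2 * k * t * D * w'
    - (N - 1) * mubar * t * D * exp (2 * rho t) ).

Definition exprY (n : Z) (a mu mubar : R) (Delta rho : R -> R) (t : R) : R :=
  let N := IZR n in
  let k := a ^ 2 - mu * t in
  let D := Delta t in
  let D' := Derive Delta t in
  let D'' := Derive_n Delta 2 t in
  let w := exprW rho t in
  let w' := Derive (exprW rho) t in
  - (1 / (t ^ 2 * D)) *
  ( a ^ 2 * D * (1 - D) * (N + (N - 2) * D)
    + (2 * a ^ 2 - 3 * mu * t) * t * D * D'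
    - k * t ^ 2 * D' ^ 2
    + 2 * k * t ^ 2 * D * D''
    + mu * t * D * (1 - D) * w
    - k * t * (1 - (N - 1) * D) * D' * w
    - (N - 2) * k * D * (1 - D) * w ^ 2
    - 2 * k * t * D * (1 - D) * w'
    - (N - 1) * mubar * t * D * (1 - D) * exp (2 * rho t) ).

Definition exprZ (n : Z) (a mu : R) (Delta rho : R -> R) (t : R) : R :=
  let N := IZR n in
  let k := a ^ 2 - mu * t in
  let D := Delta t in
  let D' := Derive Delta t in
  let D'' := Derive_n Delta 2 t in
  let w := exprW rho t in
  let w' := Derive (exprW rho) t in
  - (1 / (k * t ^ 2 * D ^ 2)) *
  ( a ^ 2 * D ^ 2 * (N - 2 * D)
    + (2 * a ^ 2 - 3 * mu * t) * t * D * D'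
    - k * t ^ 2 * D' ^ 2
    + 2 * k * t ^ 2 * D * D''
    - (N - 2) * mu * t * D ^ 2 * w
    - (N - 2) * k * D ^ 2 * w ^ 2
    + 2 * (N - 2) * k * t * D ^ 2 * w' ).

Definition exprT (a mu : R) (Delta rho : R -> R) (t : R) : R :=
  let k := a ^ 2 - mu * t in
  let D := Delta t in
  let D' := Derive Delta t in
  let w := exprW rho t in
  let w' := Derive (exprW rho) t in
  k * (D ^ 2 - t * D' * w - D * w ^ 2 + 2 * t * D * w')
  + mu * t * (D ^ 2 - D * w).

(* Main.v *)
(* Write {X}, {Y}, {Z} for the braces.  Then {Z} - ({Y} - (1 - D){X}) equals
   (n - 2) D T, so X = Y = Z = 0 gives T = 0.  Conversely {X} + T contains no
   derivative of W = 1 + 2 b^2 rho'; since (e^{2 rho})' b^2 = (W - 1) e^{2 rho},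
   differentiating {X} + T = 0 eliminates the exponential, and modulo T = 0 the
   result is W ({Y} - (1 - D){X}) = 0.  As W <> 0 this gives Y = 0, then Z = 0. *)
Require Import Defs.
From Stdlib Require Import Reals ZArith Lra.
From Coquelicot Require Import Coquelicot.
Local Open Scope R_scope.

Lemma in_itv_locally (lo : R) (hi : Rbar) (t : R) :
  in_itv lo hi t -> locally t (in_itv lo hi).
Proof.
intros [h1 h2].
apply filter_and.
- exact (open_gt lo t h1).
- exact (open_Rbar_lt' t hi h2).
Qed.

(** Clearing the prefactor, rather than copying the brace, makes [X = 0] give a zero brace at once;
    conversely a zero brace gives [X = 0] where the prefactor is nonzero. The same holds for
    [braceY] and [braceZ]. *)
Definition braceX (n : Z) (a mu mubar : R) (Delta rho : R -> R) (t : R) : R :=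
  t * Delta t * exprX n a mu mubar Delta rho t.

Definition braceY (n : Z) (a mu mubar : R) (Delta rho : R -> R) (t : R) : R :=
  - (t ^ 2 * Delta t) * exprY n a mu mubar Delta rho t.

Definition braceZ (n : Z) (a mu : R) (Delta rho : R -> R) (t : R) : R :=
  - ((a ^ 2 - mu * t) * t ^ 2 * Delta t ^ 2) * exprZ n a mu Delta rho t.

(** Subtracting [(1 - D){X}] from [{Y}] cancels the exponential and every term in [w'] and [w ^ 2].
    What is left has the same terms in [D''] and [D' ^ 2] as [{Z}], so these cancel in turn. *)
Lemma braceZ_sub_braceY (n : Z) (a mu mubar : R) (Delta rho : R -> R) (t : R) :
  t <> 0 -> Delta t <> 0 -> a ^ 2 - mu * t <> 0 ->
  braceZ n a mu Delta rho t
  - (braceY n a mu mubar Delta rho t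
     - (1 - Delta t) * braceX n a mu mubar Delta rho t)
  = (IZR n - 2) * Delta t * exprT a mu Delta rho t.
Proof.
intros ht hD hk.
unfold braceX, braceY, braceZ, exprX, exprY, exprZ, exprT; cbv zeta.
field; auto.
Qed.

(** Closed form of [{X} + T]: the [w'] terms have cancelled, and [k + mu t = a ^ 2] merges the
    [D ^ 2] terms. *)
Definition firstOrder (n : Z) (a mu mubar : R) (Delta rho : R -> R) (t : R) : R :=
  let N := IZR n in
  let k := a ^ 2 - mu * t in
  let w := exprW rho t in
  a ^ 2 * Delta t * (N - Delta t)
  - 2 * k * t * Derive Delta t * w
  - (N - 1) * k * Delta t * w ^ 2
  - (N - 1) * mubar * t * Delta t * exp (2 * rho t).

Lemma braceX_add_exprT (n : Z) (a mu mubar : R) (Delta rho : R -> R) (t : R) :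
  t <> 0 -> Delta t <> 0 ->
  braceX n a mu mubar Delta rho t + exprT a mu Delta rho t
  = firstOrder n a mu mubar Delta rho t.
Proof.
intros ht hD.
unfold braceX, exprX, exprT, firstOrder; cbv zeta.
field; auto.
Qed.

Lemma ex_derive_exprW (rho : R -> R) (t : R) :
  ex_derive (Derive rho) t -> ex_derive (exprW rho) t.
Proof.
intros h; unfold exprW.
auto_derive; auto.
Qed.

(** The multipliers are forced. Since [t D] times the derivative of [t D exp (2 rho)] is
    [t D' + w D] times that function, the first two terms on the right have no exponential. The
    coefficient of [T] is the one that removes [w'], which enters [- t D Q'] as
    [2 k t D (t D' + (N - 1) w D) w']. *)
Lemma braceY_from_firstOrder (n : Z) (a mu mubar : R) (Delta rho : R -> R) (t : R) :
  t <> 0 -> Delta t <> 0 ->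
  ex_derive Delta t -> ex_derive (Derive Delta) t ->
  ex_derive rho t -> ex_derive (Derive rho) t ->
  let Q := firstOrder n a mu mubar Delta rho in
  let D := Delta t in
  let D' := Derive Delta t in
  let w := exprW rho t in
  w * (braceY n a mu mubar Delta rho t
       - (1 - D) * braceX n a mu mubar Delta rho t)
  = (t * D' + w * D) * Q t - t * D * Derive Q t
    - (t * D' + (IZR n - 1) * w * D) * exprT a mu Delta rho t.
Proof.
intros ht hD hD1 hD2 hr1 hr2; cbv zeta.
assert (hw := ex_derive_exprW rho t hr2).
assert (hQ : is_derive (firstOrder n a mu mubar Delta rho) t
  (a ^ 2 * Derive Delta t * (IZR n - 2 * Delta t)
   - 2 * (a ^ 2 - 2 * mu * t) * Derive Delta t * exprW rho t
   - 2 * (a ^ 2 - mu * t) * t * Derive_n Delta 2 t * exprW rho t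
   - 2 * (a ^ 2 - mu * t) * t * Derive Delta t * Derive (exprW rho) t
   - (IZR n - 1) * ((a ^ 2 - mu * t) * Derive Delta t - mu * Delta t)
     * exprW rho t ^ 2
   - 2 * (IZR n - 1) * (a ^ 2 - mu * t) * Delta t * exprW rho t
     * Derive (exprW rho) t
   - (IZR n - 1) * mubar * (Delta t * exprW rho t + t * Derive Delta t)
     * exp (2 * rho t))).
(* Differentiating [t D exp (2 rho)] yields [D (1 + 2 t rho')], which has to be recognised as
   [D w]. *)
{ assert (hWt : exprW rho t = 1 + 2 * t * Derive rho t) by reflexivity.
  unfold firstOrder; cbv zeta.
  auto_derive.
  - repeat split; assumption.
  - change (Derive_n Delta 2 t) with (Derive (Derive Delta) t).
    change (Derive (fun x => Derive Delta x) t) with (Derive (Derive Delta) t).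
    change (Derive (fun x => exprW rho x) t) with (Derive (exprW rho) t).
    change (Derive (fun x => Delta x) t) with (Derive Delta t).
    change (Derive (fun x => rho x) t) with (Derive rho t).
    generalize (Derive (exprW rho) t); intros w'.
    rewrite hWt; ring. }
rewrite (is_derive_unique _ _ _ hQ).
unfold braceX, braceY, exprX, exprY, exprT, firstOrder; cbv zeta.
field; auto.
Qed.

Theorem lemma5p2 (n : Z) (a mu mubar : R) (lo : R) (hi : Rbar)
  (Delta rho : R -> R)
  (hn : (2 < n)%Z)
  (ha : a <> 0)
  (hlo : 0 <= lo)
  (hlohi : Rbar_lt lo hi)
  (hpos : forall t : R, in_itv lo hi t -> 0 < a ^ 2 - mu * t)
  (hDelta_smooth : smooth_on lo hi Delta)
  (hrho_smooth : smooth_on lo hi rho)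
  (hDelta_pos : forall t : R, in_itv lo hi t -> 0 < Delta t)
  (hW : forall t : R, in_itv lo hi t -> exprW rho t <> 0) :
  (forall t : R, in_itv lo hi t ->
     exprX n a mu mubar Delta rho t = 0 /\
     exprY n a mu mubar Delta rho t = 0 /\
     exprZ n a mu Delta rho t = 0)
  <->
  (forall t : R, in_itv lo hi t ->
     exprX n a mu mubar Delta rho t = 0 /\
     exprT a mu Delta rho t = 0).
Proof.
assert (hN : 2 < IZR n) by (apply IZR_lt; exact hn).
assert (ht : forall t, in_itv lo hi t -> t <> 0)
  by (intros t [h _]; lra).
assert (hD : forall t, in_itv lo hi t -> Delta t <> 0)
  by (intros t h; specialize (hDelta_pos t h); lra).
assert (hk : forall t, in_itv lo hi t -> a ^ 2 - mu * t <> 0)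
  by (intros t h; specialize (hpos t h); lra).
split; intros H t I; specialize (ht t I) as t0; specialize (hD t I) as D0;
  specialize (hk t I) as k0;
  assert (hZY := braceZ_sub_braceY n a mu mubar Delta rho t t0 D0 k0).
- destruct (H t I) as (HX & HY & HZ).
  split; [exact HX|].
  unfold braceX, braceY, braceZ in hZY; rewrite HX, HY, HZ in hZY.
  (* Here [n > 2] allows division by [n - 2]. *)
  apply (Rmult_eq_reg_l ((IZR n - 2) * Delta t)).
  + rewrite <- hZY; ring.
  + apply Rmult_integral_contrapositive_currified; [lra | exact D0].
- destruct (H t I) as (HX & HT).
  assert (hQ : forall s, in_itv lo hi s ->
    firstOrder n a mu mubar Delta rho s = 0).
  { intros s Is.
    rewrite <- braceX_add_exprT by auto.
    destruct (H s Is) as (HXs & HTs).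
    unfold braceX; rewrite HXs, HTs; ring. }
  (* The interval is open, so [firstOrder] vanishes in a neighbourhood of [t] and its derivative
     there is that of the zero function. *)
  assert (hQ' : Derive (firstOrder n a mu mubar Delta rho) t = 0).
  { rewrite (Derive_ext_loc _ (fun _ => 0)); [apply Derive_const|].
    exact (filter_imp _ _ hQ (in_itv_locally lo hi t I)). }
  assert (hY := braceY_from_firstOrder n a mu mubar Delta rho t t0 D0
    (hDelta_smooth t I 1%nat) (hDelta_smooth t I 2%nat)
    (hrho_smooth t I 1%nat) (hrho_smooth t I 2%nat)); cbv zeta in hY.
  rewrite hQ, hQ', HT in hY by exact I.
  assert (hX0 : braceX n a mu mubar Delta rho t = 0)
    by (unfold braceX; rewrite HX; ring).
  assert (hY0 : braceY n a mu mubar Delta rho t = 0).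
  (* With [Q], [Q'], [T] and [{X}] all zero, [hY] reads [w {Y} = 0]. *)
  { apply (Rmult_eq_reg_l (exprW rho t)); [|exact (hW t I)].
    rewrite hX0 in hY; lra. }
  assert (hZ0 : braceZ n a mu Delta rho t = 0)
    by (rewrite hX0, hY0, HT in hZY; lra).
  unfold braceY in hY0; unfold braceZ in hZ0.
  split; [exact HX|split].
  + apply Rmult_integral in hY0; destruct hY0 as [h|h]; [exfalso|exact h].
    revert h; apply Ropp_neq_0_compat.
    auto using Rmult_integral_contrapositive_currified, pow_nonzero.
  + apply Rmult_integral in hZ0; destruct hZ0 as [h|h]; [exfalso|exact h].
    revert h; apply Ropp_neq_0_compat.
    auto using Rmult_integral_contrapositive_currified, pow_nonzero.
Qed.
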